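(* DC3 does not imply DC2 on dendrites in the sense of uncountable sets or pairs, that is: (i) there exist a dendrite $X$ and a continuous map $f:X\to X$ such that $f$ has an uncountable DC3 set but no uncountable DC2 set; and (ii) there exist a dendrite $X$ and a continuous map $f:X\to X$ such that $f$ has a DC3 pair but no DC2 pair.
   Context: A dendrite is a locally connected continuum (compact connected metric space) containing no subset homeomorphic to the circle. Let $(X,d)$ be a compact metric space and $f:X\to X$ continuous. For $x,y\in X$ and $\delta>0$ put $$\Phi_{(f,x,y)}(\delta)=\liminf_{n\to\infty}\frac1n\#\{0\le k\le n: d(f^k(x),f^k(y))<\delta\},\qquad \Phi^*_{(f,x,y)}(\delta)=\limsup_{n\to\infty}\frac1n\#\{0\le k\le n: d(f^k(x),f^k(y))<\delta\}.$$ A pair $(x,y)\in X^2$ is a DC2 pair if $\Phi^*_{(f,x,y)}(\delta)=1$ for every $0<\delta\le \operatorname{diam}X$ and $\Phi_{(f,x,y)}(\epsilon)<1$ for some $0<\epsilon\le\operatorname{diam}X$. It is a DC3 pair if there are $0\le a<b\le\operatorname{diam}X$ such that $\Phi_{(f,x,y)}(\delta)<\Phi^*_{(f,x,y)}(\delta)$ for every $\delta\in(a,b)$. For $i\in\{2,3\}$, a set $S\subset X$ is a DC$i$ set if every pair of distinct points of $S$ is a DC$i$ pair. *)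

(* Defs.v *)
From HB Require Import structures.
From mathcomp Require Import all_boot all_order all_algebra.
From mathcomp Require Import all_classical reals topology normedtype sequences.

Set Implicit Arguments.
Unset Strict Implicit.
Unset Printing Implicit Defensive.

Import Order.TTheory GRing.Theory Num.Theory.
Import numFieldTopology.Exports numFieldNormedType.Exports.

Local Open Scope classical_set_scope.
Local Open Scope ring_scope.

Definition homeomorphic (T U : topologicalType) : Prop :=
  exists (f : T -> U) (g : U -> T),
    [/\ continuous f, continuous g, cancel f g & cancel g f].

Definition locally_connected (T : topologicalType) : Prop :=
  forall (x : T) (U : set T), nbhs x U ->
    exists V : set T, [/\ open V, connected V, V x & V `<=` U].

Definition unit_circle (R : realType) : set (R * R) :=
  [set p | p.1 ^+ 2 + p.2 ^+ 2 = 1].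

Definition continuum (R : realType) (X : metricType R) : Prop :=
  [/\ [set: X] !=set0, compact [set: X] & connected [set: X]].

(* set_type A carries the initial topology of the inclusion of A. *)
Definition dendrite (R : realType) (X : metricType R) : Prop :=
  [/\ continuum X, locally_connected X &
      ~ exists A : set X,
          homeomorphic (set_type A) (set_type (@unit_circle R))].

Definition diam (R : realType) (X : metricType R) : R :=
  sup [set mdist p.1 p.2 | p in [set: X * X]].

(* At n = 0 the quotient is 0 (inverse of 0); this does not affect the lower
   and upper limits below. All values lie in [0, 2], so that limn_inf and
   limn_sup are genuine lower and upper limits. *)
Definition close_freq (R : realType) (X : metricType R) (f : X -> X)
    (x y : X) (delta : R) (n : nat) : R :=
  #|[pred k : 'I_n.+1 | mdist (iter k f x) (iter k f y) < delta]|%:R / n%:R.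

Definition Phi (R : realType) (X : metricType R) (f : X -> X)
    (x y : X) (delta : R) : R :=
  limn_inf (close_freq f x y delta).

Definition Phi_star (R : realType) (X : metricType R) (f : X -> X)
    (x y : X) (delta : R) : R :=
  limn_sup (close_freq f x y delta).

Definition DC2_pair (R : realType) (X : metricType R) (f : X -> X)
    (x y : X) : Prop :=
  (forall delta : R, 0 < delta -> delta <= diam X ->
     Phi_star f x y delta = 1) /\
  (exists eps : R, [/\ 0 < eps, eps <= diam X & Phi f x y eps < 1]).

Definition DC3_pair (R : realType) (X : metricType R) (f : X -> X)
    (x y : X) : Prop :=
  exists a b : R, [/\ 0 <= a, a < b, b <= diam X &
    forall delta : R, a < delta -> delta < b ->
      Phi f x y delta < Phi_star f x y delta].

Definition DC2_set (R : realType) (X : metricType R) (f : X -> X)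
    (S : set X) : Prop :=
  forall x y : X, S x -> S y -> x <> y -> DC2_pair f x y.

Definition DC3_set (R : realType) (X : metricType R) (f : X -> X)
    (S : set X) : Prop :=
  forall x y : X, S x -> S y -> x <> y -> DC3_pair f x y.

(* Main.v *)
Require Import Defs.
From HB Require Import structures.
From mathcomp Require Import all_boot all_order all_algebra.
From mathcomp Require Import all_classical reals topology normedtype sequences.
From mathcomp Require Import cantor.
From mathcomp Require Import ring lra zify.

Set Implicit Arguments.
Unset Strict Implicit.
Unset Printing Implicit Defensive.

Import Order.TTheory GRing.Theory Num.Theory.
Import numFieldTopology.Exports numFieldNormedType.Exports.

Local Open Scope classical_set_scope.
Local Open Scope ring_scope.

(** One system serves for both parts: a dendrite with a map that has an
    uncountable DC3 set and no DC2 pair whatsoever.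

    Endpoints. Cut the time axis into the blocks [2^n, 2^(n+1)) and give
    block n the number v(n), the exponent of 2 in n. A binary sequence [a]
    is coded by the sequence [blocks a] which is constantly a(v(n)) on block
    n. Two codes of distinct a and b differ on every block with v(n) = j, for
    some j with a(j) <> b(j); such blocks recur with bounded gaps in n, hence
    occupy a proportion of [0, N] that is bounded away from 0, so the codes
    agree with upper density less than 1 ([limn_sup_freq_lt1]). If moreover
    a and b agree somewhere, then blocks of agreement and blocks of
    disagreement both recur, and as each block doubles the elapsed time the
    frequency of agreement has no limit ([freq_dyadic_diverges]).

    The subshift. The closure of the set of all shifts of all codes adds only
    sequences with at most one switch, because far from the origin a window
    of fixed length meets at most one block boundary ([leaves_closed]). Every
    point of the closure follows a code a(v(n)) on all blocks, up to an error
    of bounded length at each block end ([leaves_trace]; for an eventually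
    constant sequence take a constant). Two points that follow the same a
    thus disagree only O(log N) times up to N, so they are close with
    density 1 ([limn_inf_freq1]); two points that follow different codes agree
    with upper density less than 1. Neither is possible for a DC2 pair.

    The dendrite. The leaves span a rooted tree: two leaves that first differ
    at index n share the branch from the root, at height 0, up to height
    1 - 2^-n. It is compact since the subshift is, its balls are connected
    since they are unions of arcs ([ball_connected]), and it contains no
    circle because any two of its points are separated by a third one
    ([tree_cut]), whereas removing a point from a circle leaves a connected
    set ([punctured_circle_connected]). The shift of leaves together with
    t |-> max(0, 2t - 1) on heights is a 2-Lipschitz map of the tree. Every
    point that is not a leaf reaches the root, which stays at distance 1 from
    all leaves; so pairs involving such points are not DC2 either
    ([no_DC2_pair]). *)

(** * Metric spaces *)

Section MetricSpaces.
Variable R : realType.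

Lemma nbhs_mdist_ballP (X : metricType R) (x : X) (U : set X) :
  nbhs x U <-> exists2 e : R, 0 < e & forall y, mdist x y < e -> U y.
Proof.
rewrite -metricType_numDomainType.filter_from_mdist_nbhs.
by split=> -[e e0 h]; exists e.
Qed.

Lemma open_mdist_ball (X : metricType R) (x : X) (e : R) :
  open [set y | mdist x y < e].
Proof.
rewrite openE => y /= xy; apply/nbhs_mdist_ballP.
exists (e - mdist x y); first by rewrite subr_gt0.
move=> z yz; apply: le_lt_trans (metric_triangle x y z) _; lra.
Qed.

Lemma lipschitz_continuous (X Y : metricType R) (k : R) (f : X -> Y) : 0 < k ->
  (forall x y, mdist (f x) (f y) <= k * mdist x y) -> continuous f.
Proof.
move=> k0 fk x; apply/metricType_numDomainType.cvgrPdist_lt => e e0.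
apply/nbhs_mdist_ballP; exists (e / k); first by rewrite divr_gt0.
by move=> y; rewrite ltr_pdivlMr// mulrC; exact: le_lt_trans.
Qed.

End MetricSpaces.

(** * The rooted tree spanned by an ultrametric set of leaves *)

(** The height at which the branches from the root to two leaves part.
    [merge_ultra] says that 1 - merge is a pseudo-ultrametric; leaves have
    height 1. *)
Record merging (R : realType) := Merging {
  leaf : choiceType;
  merge : leaf -> leaf -> R;
  merge_ge0 : forall x y, 0 <= merge x y;
  merge_refl : forall x, merge x x = 1;
  merge_sym : forall x y, merge x y = merge y x;
  merge_ultra : forall y x z,
    Num.min (merge x y) (merge y z) <= merge x z }.

Section Tree.
Variables (R : realType) (L : merging R).

(** A representative (l, t) of the point at height t on the branch from the
    root to l. *)
Definition stem : Type := leaf L * R.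
HB.instance Definition _ := Choice.on stem.

(** Clamping to [0, 1] lets the second coordinate range over all reals, so
    that a branch is parametrized by a total continuous function. *)
Definition height (p : stem) : R := Num.max 0 (Num.min 1 p.2).

(** The height at which the branches leading to p and q part. *)
Definition meet (p q : stem) : R :=
  Num.min (Num.min (height p) (height q)) (merge p.1 q.1).

Definition stem_dist (p q : stem) : R := height p + height q - 2 * meet p q.

Lemma height_ge0 p : 0 <= height p.
Proof. by rewrite /height le_max lexx. Qed.

Lemma height_le1 p : height p <= 1.
Proof. by rewrite /height ge_max ler01 ge_min lexx. Qed.

Lemma height_id x t : 0 <= t <= 1 -> height (x, t) = t.
Proof. by case/andP=> t0 t1; rewrite /height /= (min_r t1) (max_r t0). Qed.

Lemma heightB x s t : `|height (x, s) - height (x, t)| <= `|s - t|.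
Proof.
wlog st : s t / s <= t => [h|].
  by case: (leP s t) => [/h//|/ltW /h]; rewrite distrC (distrC t).
rewrite !(distrC s) (distrC (height (x, s))) /height /=.
have -> : `|t - s| = t - s by rewrite ger0_norm// subr_ge0.
case: (leP 1 s) => hs; case: (leP 1 t) => ht;
  (case: (leP 0 s) => h0; case: (leP 0 t) => h1);
  rewrite ?(max_r ler01) ?(max_r h0) ?(max_r h1) ?(max_l (ltW h0)) ?(max_l
    (ltW h1));
  rewrite ?ler_norml; lra.
Qed.

Lemma meet_sym p q : meet p q = meet q p.
Proof. by rewrite /meet merge_sym (minC (height p)). Qed.

Lemma meet_refl p : meet p p = height p.
Proof. by rewrite /meet merge_refl minxx min_l// height_le1. Qed.

Lemma meet_lel p q : meet p q <= height p.
Proof. by rewrite /meet !ge_min lexx. Qed.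

Lemma meet_ler p q : meet p q <= height q.
Proof. by rewrite meet_sym meet_lel. Qed.

Lemma meet_ge0 p q : 0 <= meet p q.
Proof. by rewrite /meet !le_min !height_ge0 merge_ge0. Qed.

Lemma meet_ultra q p r : Num.min (meet p q) (meet q r) <= meet p r.
Proof.
have hp : Num.min (meet p q) (meet q r) <= meet p q by rewrite ge_min lexx.
have hr : Num.min (meet p q) (meet q r) <= meet q r.
  by rewrite ge_min lexx orbT.
rewrite [leRHS]/meet !le_min (le_trans hp (meet_lel _ _)).
rewrite (le_trans hr (meet_ler _ _)) /=.
apply: le_trans (merge_ultra q.1 _ _); rewrite le_min.
rewrite (le_trans hp)/=; last by rewrite /meet ge_min lexx orbT.
by rewrite (le_trans hr)// /meet ge_min lexx orbT.
Qed.

Lemma stem_dist_sym p q : stem_dist p q = stem_dist q p.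
Proof. by rewrite /stem_dist meet_sym (addrC (height p)). Qed.

Lemma stem_dist_refl p : stem_dist p p = 0.
Proof. by rewrite /stem_dist meet_refl; lra. Qed.

(** The smaller of the two meets on the right is at most [meet p r] by
    [meet_ultra], and the larger one is at most [height q]. *)
Lemma stem_dist_triangle q p r :
  stem_dist p r <= stem_dist p q + stem_dist q r.
Proof.
rewrite /stem_dist; have := meet_ler p q; have := meet_lel q r.
by have := meet_ultra q p r; rewrite ge_min => /orP[] ? ? ?; lra.
Qed.

Lemma stem_dist_ge0 p q : 0 <= stem_dist p q.
Proof.
by rewrite /stem_dist; have := meet_lel p q; have := meet_ler p q; lra.
Qed.

(** Two representatives name the same point exactly when they have the same
    height, at most the merging height of their leaves; that is when their
    distance vanishes. *)
Definition stem_eq (p q : stem) : bool := stem_dist p q == 0.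

Lemma stem_eq_equiv : equiv_class_of stem_eq.
Proof.
split=> [p|p q|q p r]; rewrite /stem_eq.
- by rewrite stem_dist_refl.
- by rewrite stem_dist_sym.
- move=> /eqP h1 /eqP h2; rewrite eq_le stem_dist_ge0 andbT.
  by rewrite (le_trans (stem_dist_triangle q p r))// h1 h2 addr0.
Qed.

Canonical stem_equiv := EquivRelPack stem_eq_equiv.

Definition tree : Type := {eq_quot stem_equiv}%qT.
HB.instance Definition _ := Choice.on tree.
HB.instance Definition _ := EqQuotient.on tree.

Definition at_stem (p : stem) : tree := (\pi_tree p)%qT.

Definition tree_dist (x y : tree) : R := stem_dist (repr x) (repr y).

Lemma at_stem_repr x : at_stem (repr x) = x.
Proof. exact: reprK. Qed.

Lemma at_stem_eq p q : at_stem p = at_stem q <-> stem_dist p q = 0.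
Proof.
split=> [h|/eqP h]; last exact/eqquotP.
by apply/eqP; move/eqquotP: h.
Qed.

Lemma tree_distE p q : tree_dist (at_stem p) (at_stem q) = stem_dist p q.
Proof.
have h u : stem_dist (repr (at_stem u)) u = 0.
  by apply/at_stem_eq; rewrite at_stem_repr.
apply/eqP; rewrite eq_le /tree_dist; apply/andP; split.
- apply: (le_trans (stem_dist_triangle p _ _)); rewrite h add0r.
  by apply: (le_trans (stem_dist_triangle q _ _));
    rewrite (stem_dist_sym q) h addr0.
- apply: (le_trans (stem_dist_triangle (repr (at_stem p)) _ _)).
  rewrite (stem_dist_sym p) h add0r.
  by apply: (le_trans (stem_dist_triangle (repr (at_stem q)) _ _));
    rewrite h addr0.
Qed.

Lemma tree_dist_refl x : tree_dist x x = 0.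
Proof. exact: stem_dist_refl. Qed.

Lemma tree_dist_eq0 x y : tree_dist x y = 0 -> x = y.
Proof.
by move=> h; rewrite -(at_stem_repr x) -(at_stem_repr y); apply/at_stem_eq.
Qed.

Lemma tree_dist_sym x y : tree_dist x y = tree_dist y x.
Proof. exact: stem_dist_sym. Qed.

Lemma tree_dist_triangle y x z : tree_dist x z <= tree_dist x y + tree_dist y z.
Proof. exact: stem_dist_triangle. Qed.

HB.instance Definition _ := @isMetric.Build R tree tree_dist
  tree_dist_refl tree_dist_eq0 tree_dist_sym tree_dist_triangle.

Lemma mdist_tree p q : mdist (at_stem p) (at_stem q) = stem_dist p q.
Proof. exact: tree_distE. Qed.

End Tree.

(** * Topology of the tree *)

Section TreeTopology.
Variables (R : realType) (L : merging R).
Implicit Types p q : stem L.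

(** Together with [stem_continuous], the source of all connected sets below:
    branches are continuous images of intervals. *)
Lemma stem_dist_lift (l : leaf L) (s t : R) :
  stem_dist (l, s) (l, t) <= `|s - t| :> R.
Proof.
apply: le_trans (heightB l s t); rewrite /stem_dist /meet /= (@merge_refl _ L).
rewrite (min_l (_ : _ <= 1)); last by rewrite ge_min height_le1.
have := ler_norm (height (l, s) - height (l, t)).
have := ler_norm (height (l, t) - height (l, s)); rewrite distrC.
by case: (leP (height (l, s))); lra.
Qed.

Lemma stem_continuous (l : leaf L) : continuous (fun t : R => at_stem (l, t)).
Proof.
move=> s; apply/metricType_numDomainType.cvgrPdist_lt => e e0.
near=> t; rewrite mdist_tree; apply: le_lt_trans (stem_dist_lift l s t) _.
near: t; exact: cvgr_dist_lt.
Unshelve. all: by end_near. Qed.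

Definition rise p (a : R) : set (tree L) :=
  (fun t => at_stem (p.1, t)) @` `[a, height p].

Lemma rise_connected p a : connected (rise p a).
Proof.
apply: connected_continuous_connected; first exact: segment_connected.
by apply: continuous_subspaceT; exact: stem_continuous.
Qed.

Lemma at_stem_height p : at_stem (p.1, height p) = at_stem p.
Proof.
have e : height (p.1, height p) = height p.
  by rewrite height_id// height_ge0 height_le1.
apply/at_stem_eq; rewrite /stem_dist /meet e (@merge_refl _ L) minxx.
by rewrite min_l ?height_le1//; lra.
Qed.

Lemma rise_top p a : a <= height p -> rise p a (at_stem p).
Proof.
by move=> h; exists (height p);
  [rewrite /= in_itv /= h lexx|exact: at_stem_height].
Qed.

(** Down from p to the branching height and up again to q. *)
Definition arc p q := rise p (meet p q) `|` rise q (meet p q).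

Lemma arc_left p q : arc p q (at_stem p).
Proof. by left; apply: rise_top; exact: meet_lel. Qed.

Lemma arc_right p q : arc p q (at_stem q).
Proof. by right; apply: rise_top; exact: meet_ler. Qed.

Lemma arc_connected p q : connected (arc p q).
Proof.
apply: connectedU; [|exact: rise_connected|exact: rise_connected].
exists (at_stem (p.1, meet p q)); split.
  by exists (meet p q); rewrite //= in_itv /= lexx meet_lel.
exists (meet p q); first by rewrite /= in_itv /= lexx meet_ler.
set m := meet p q.
have hm l : height (l, m) = m.
  by rewrite height_id// meet_ge0 (le_trans (meet_lel _ _) (height_le1 _)).
have mm : m <= merge q.1 p.1 by rewrite merge_sym /m /meet ge_min lexx orbT.
by apply/at_stem_eq; rewrite /stem_dist /meet !hm /= minxx min_l//; lra.
Qed.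

(** Going from one end of an arc to the other the distance to the starting
    point never exceeds its final value, so that balls are unions of arcs. *)
Lemma arc_dist p q z : arc p q z ->
  mdist (at_stem p) z <= mdist (at_stem p) (at_stem q).
Proof.
have in01 r t : t <= height r -> meet p q <= t -> height (r.1, t) = t.
  move=> t1 t0; rewrite height_id// (le_trans (meet_ge0 _ _) t0).
  exact: le_trans t1 (height_le1 _).
have mq : meet p q <= merge p.1 q.1 by rewrite /meet ge_min lexx orbT.
have mp := meet_lel p q.
move=> [] [t /=]; rewrite in_itv /= => /andP[t0 t1] <-;
  rewrite !mdist_tree /stem_dist in01//.
- have -> : meet p (p.1, t) = t.
    rewrite /meet in01//= (min_r t1) merge_refl min_l//.
    exact: le_trans t1 (height_le1 _).
  by have := meet_ler p q; lra.
- have : meet p q <= meet p (q.1, t).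
    by rewrite [leRHS]/meet in01//= !le_min mp t0.
  lra.
Qed.

Lemma ball_connected (x : tree L) e : connected [set y | mdist x y < e].
Proof.
rewrite -(at_stem_repr x); set p := repr x.
have -> : [set y | mdist (at_stem p) y < e] =
    \bigcup_(q in [set q | mdist (at_stem p) (at_stem q) < e]) arc p q.
  apply/seteqP; split=> [y /= py|y [q /= pq] /arc_dist h].
    exists (repr y); first by rewrite /= at_stem_repr.
    by rewrite -{2}(at_stem_repr y); exact: arc_right.
  exact: le_lt_trans h pq.
apply: bigcup_connected; last by move=> *; exact: arc_connected.
by exists (at_stem p) => q _; exact: arc_left.
Qed.

Lemma tree_locally_connected : locally_connected (tree L).
Proof.
move=> x U /nbhs_mdist_ballP[e e0 xU]; exists [set y | mdist x y < e]; split.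
- exact: open_mdist_ball.
- exact: ball_connected.
- by rewrite /= mdistxx.
- by move=> y /xU.
Qed.

Lemma tree_dist_le2 (x y : tree L) : mdist x y <= 2.
Proof.
rewrite -(at_stem_repr x) -(at_stem_repr y) mdist_tree /stem_dist.
have := meet_ge0 (repr x) (repr y).
have := height_le1 (repr x); have := height_le1 (repr y); lra.
Qed.

Lemma tree_connected : connected [set: tree L].
Proof.
have [->|/set0P[x _]] := eqVneq [set: tree L] set0; first exact: connected0.
have -> : [set: tree L] = [set y | mdist x y < 3].
  by apply/seteqP; split=> // y _ /=;
    apply: le_lt_trans (tree_dist_le2 x y) _; lra.
exact: ball_connected.
Qed.

(** The tree is the image of the compact set A x [0, 1], and the assumption
    on [l] is what makes this parametrization continuous. *)
Lemma tree_compact (K : topologicalType) (A : set K) (l : K -> leaf L) :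
  compact A -> (forall x, exists2 k, A k & l k = x) ->
  (forall k e, A k -> 0 < e ->
     \forall k' \near k, A k' -> 1 - e <= merge (l k) (l k')) ->
  compact [set: tree L].
Proof.
move=> cA ls lc; pose g (u : K * R) : tree L := at_stem (l u.1, u.2).
have -> : [set: tree L] = g @` (A `*` `[0, 1]).
  apply/seteqP; split=> // x _; have [k Ak kx] := ls (repr x).1.
  exists (k, height (repr x));
    last by rewrite /g /= kx at_stem_height at_stem_repr.
  by split=> //=; rewrite in_itv /= height_ge0 height_le1.
apply: continuous_compact; last exact: compact_setX cA (@segment_compact _ _ _).
apply/subspace_continuousP => -[k s] [/= Ak _].
apply/metricType_numDomainType.cvgrPdist_lt => e e0; rewrite near_withinE.
have e4 : 0 < e / 4 by rewrite divr_gt0.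
have ns : \forall u \near (k, s), `|s - u.2| < e / 4.
  have : (fun u : K * R => u.2) @ nbhs (k, s) --> s by exact: cvg_snd.
  by move=> /cvgr_dist_lt; exact.
have nk : \forall u \near (k, s), A u.1 -> 1 - e / 4 <= merge (l k) (l u.1).
  exact: cvg_fst (lc k _ Ak e4).
apply: filterS2 ns nk => u us uk [/uk {}uk _]; rewrite /g /=.
apply: le_lt_trans (metric_triangle _ (at_stem (l k, u.2)) _) _.
rewrite !mdist_tree; have := stem_dist_lift (l k) s u.2.
have : stem_dist (l k, u.2) (l u.1, u.2) <= e / 2.
  rewrite /stem_dist /meet /=; set h := height _.
  have -> : height (l u.1, u.2) = h by [].
  have h1 : h <= 1 := height_le1 _.
  by rewrite minxx; case: (leP h); lra.
lra.
Qed.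

(** Points that leave the branch of p below height r form an open set, and so
    do, by [open_above], the points strictly above the one at height r on
    that branch; the latter point is the only one in neither set. *)
Let open_below p r : open [set z : tree L | meet p (repr z) < r].
Proof.
rewrite openE => z /= zr; apply/nbhs_mdist_ballP.
exists (r - meet p (repr z)); first by rewrite subr_gt0.
move=> w; have -> : mdist z w = stem_dist (repr z) (repr w) by [].
rewrite /stem_dist => zw; rewrite /= ltNge; apply/negP => wr.
have := meet_ultra (repr w) p (repr z); rewrite ge_min => /orP[]; first lra.
rewrite (meet_sym (repr w)).
have := meet_ler p (repr w); have := meet_lel (repr z) (repr w).
lra.
Qed.

Let open_above p r :
  open [set z : tree L | r < height (repr z) /\ r <= meet p (repr z)].
Proof.
rewrite openE => z /= [rz rpz]; apply/nbhs_mdist_ballP.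
exists (height (repr z) - r); first by rewrite subr_gt0.
move=> w; have -> : mdist z w = stem_dist (repr z) (repr w) by [].
have := meet_ler (repr z) (repr w); rewrite /stem_dist => h zw.
have rzw : r < meet (repr z) (repr w) by lra.
split; first exact: lt_le_trans rzw h.
by apply: le_trans (meet_ultra (repr z) _ _); rewrite le_min rpz ltW.
Qed.

(** If y is not above x, the branch to x continues strictly above its meeting
    point with the branch to y; any point in between cuts x from y. *)
Lemma tree_cut (x y : tree L) : x <> y -> exists c : tree L,
  [/\ c <> x, c <> y & forall C, connected C -> C x -> C y -> C c].
Proof.
wlog mx : x y / meet (repr x) (repr y) < height (repr x) => [hw xy|xy].
  have [mx|mx] := ltP (meet (repr x) (repr y)) (height (repr x)).
    exact: hw.
  have [my|my] := ltP (meet (repr x) (repr y)) (height (repr y)).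
    have [|c [? ? h]] := hw y x _ (nesym xy); first by rewrite meet_sym.
    by exists c; split=> // C *; apply: h.
  exfalso; apply: xy; apply: mdist_positivity.
  apply/eqP; rewrite eq_le mdist_ge0 andbT.
  have -> : mdist x y = stem_dist (repr x) (repr y) by [].
  by rewrite /stem_dist; lra.
set p := repr x; set q := repr y.
(* A height strictly between the branching height and that of x. *)
pose r := (meet p q + height p) / 2.
have rp : r < height p by rewrite /r /p /q; lra.
have qr : meet p q < r by rewrite /r /p /q; lra.
have h01 := height_le1 p; have m0 := meet_ge0 p q.
have hc : height (p.1, r) = r by rewrite height_id//; apply/andP; split; lra.
have mpc : meet p (p.1, r) = r.
  by rewrite /meet hc (min_r (ltW rp)) merge_refl min_l//; lra.
exists (at_stem (p.1, r)); split.
- move=> cx; have : stem_dist (p.1, r) p = 0.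
    by apply/at_stem_eq; rewrite cx at_stem_repr.
  by rewrite /stem_dist hc meet_sym mpc; lra.
- move=> cy; have : stem_dist (p.1, r) q = 0.
    by apply/at_stem_eq; rewrite cy at_stem_repr.
  rewrite /stem_dist hc.
  have := meet_ultra (p.1, r) p q; rewrite mpc ge_min leNgt qr /=.
  have := meet_ler (p.1, r) q; lra.
move=> C cC Cx Cy; apply: contrapT => nCc.
pose U := [set z : tree L | r < height (repr z) /\ r <= meet p (repr z)].
pose V := [set z : tree L | meet p (repr z) < r].
have CU : C `&` U = C.
  apply: cC.
  - by exists x; split=> //; split=> //; rewrite /= meet_refl ltW.
  - by exists U => //; exact: open_above.
  - exists (~` V); first exact/open_closedC/open_below.
    apply/seteqP; split=> z [Cz]; rewrite /U /V /=.
      by move=> [_ rz]; split=> //; apply/negP; rewrite -leNgt.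
    move=> /negP; rewrite -leNgt => rz; split=> //; split=> //.
    rewrite lt_neqAle (le_trans rz (meet_ler _ _)) andbT; apply/eqP => rE.
    apply: nCc; rewrite (_ : at_stem _ = z)//; rewrite -(at_stem_repr z).
    have hz := meet_ler p (repr z).
    apply/at_stem_eq; rewrite /stem_dist hc -rE.
    suff -> : meet (p.1, r) (repr z) = r by lra.
    rewrite /meet hc -rE minxx min_l//=.
    by apply: le_trans rz _; rewrite /meet ge_min lexx orbT.
have : (C `&` U) y by rewrite CU.
by move=> [_ [_ /=]]; rewrite leNgt qr.
Qed.

End TreeTopology.

(** * Circles and cut points *)

Section Circle.
Variable R : realType.

Let circle := set_type (@unit_circle R).

(** The inverse of the stereographic projection, followed by the rotation
    that takes its centre (1, 0) to [q]. *)
Definition stereo (q : R * R) (t : R) : R * R :=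
  let u := (t * t - 1) * (t * t + 1)^-1 in
  let w := (t + t) * (t * t + 1)^-1 in
  (q.1 * u - q.2 * w, q.2 * u + q.1 * w).

Let sqrD1_gt0 (t : R) : 0 < t * t + 1.
Proof. nra. Qed.

Lemma stereo_circle q t : unit_circle q -> unit_circle (stereo q t).
Proof.
rewrite /unit_circle /stereo /= => q1; have := sqrD1_gt0 t.
move: q1; case: q => c d /= q1 t0.
have -> : (c * ((t * t - 1) * (t * t + 1)^-1) - d * ((t + t) * (t * t +
  1)^-1)) ^+ 2 +
  (d * ((t * t - 1) * (t * t + 1)^-1) + c * ((t + t) * (t * t + 1)^-1)) ^+ 2 =
  (c ^+ 2 + d ^+ 2) * (((t * t + 1) / (t * t + 1)) ^+ 2) by field;
    rewrite gt_eqF.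
by rewrite q1 divff ?gt_eqF// expr1n mulr1.
Qed.

Lemma stereo_continuous q : continuous (stereo q).
Proof.
move=> t; have cV : {for t, continuous (fun t : R => (t * t + 1)^-1)}.
  apply: continuousV; first by rewrite gt_eqF.
  by apply: continuousD; [apply: continuousM|exact: cst_continuous].
have cu : {for t, continuous (fun t : R => (t * t - 1) * (t * t + 1)^-1)}.
  apply: continuousM cV.
  by apply: continuousB; [apply: continuousM|exact: cst_continuous].
have cw : {for t, continuous (fun t : R => (t + t) * (t * t + 1)^-1)}.
  by apply: continuousM cV; apply: continuousD.
have cc (c : R) : {for t, continuous (fun _ : R => c)} by exact: cst_continuous.
have ca := continuousB (continuousM (cc q.1) cu) (continuousM (cc q.2) cw).
have cb := continuousD (continuousM (cc q.2) cu) (continuousM (cc q.1) cw).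
exact: cvg_pair ca cb.
Qed.

Lemma stereo_neq q t : unit_circle q -> stereo q t <> q.
Proof.
case: q => c d; rewrite /unit_circle /stereo /= => q1 [h1 h2].
have t0 := sqrD1_gt0 t.
have : (c ^+ 2 + d ^+ 2) * ((t * t - 1) / (t * t + 1)) = c ^+ 2 + d ^+ 2.
  transitivity (c * c + d * d); last by ring.
  by rewrite -{2}h1 -{4}h2; field; rewrite gt_eqF.
rewrite q1 mul1r => /(congr1 ( *%R^~ (t * t + 1))).
by rewrite mulfVK ?gt_eqF// mul1r; lra.
Qed.

Lemma stereo_onto q z : unit_circle q -> unit_circle z -> z <> q ->
  exists t, stereo q t = z.
Proof.
case: q z => c d [a b]; rewrite /unit_circle /stereo /= => q1 z1 zq.
pose u := c * a + d * b; pose w := c * b - d * a.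
have uw : u ^+ 2 + w ^+ 2 = 1.
  by rewrite -(mulr1 1) -{1}q1 -z1 /u /w; ring.
have ea : a = c * u - d * w by rewrite -[LHS]mul1r -q1 /u /w; ring.
have eb : b = d * u + c * w by rewrite -[LHS]mul1r -q1 /u /w; ring.
have u1 : 1 - u != 0.
  apply/eqP => hu; have u1 : u = 1 by lra.
  have w0 : w = 0 by apply/eqP; rewrite -sqrf_eq0; apply/eqP;
    rewrite u1 in uw; lra.
  by apply: zq; rewrite ea eb u1 w0; congr (_, _); ring.
have w2 : w * w = (1 - u) * (1 + u) by rewrite -[LHS]expr2; lra.
exists (w / (1 - u)).
have -> : w / (1 - u) * (w / (1 - u)) = (1 + u) / (1 - u).
  have -> : w / (1 - u) * (w / (1 - u)) = w * w / (1 - u) / (1 - u) by field.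
  by rewrite w2; field.
have -> : (1 + u) / (1 - u) - 1 = 2 * u / (1 - u) by field.
have -> : (1 + u) / (1 - u) + 1 = 2 / (1 - u) by field.
have -> : 2 * u / (1 - u) / (2 / (1 - u)) = u by field.
have -> : (w / (1 - u) + w / (1 - u)) / (2 / (1 - u)) = w by field.
by rewrite -ea -eb.
Qed.

Lemma punctured_circle_connected (q : circle) : connected [set z | z <> q].
Proof.
have qc : unit_circle (set_val q) by exact: set_valP.
pose g t : circle := exist _ (stereo (set_val q) t) (mem_set (stereo_circle t
  qc)).
have -> : [set z | z <> q] = g @` [set: R].
  apply/seteqP; split=> [z /= zq|_ [t _ <-] /(congr1 set_val)]; last first.
    exact: stereo_neq.
  have [|t tz] := stereo_onto qc (set_valP z).
    by move=> h; apply: zq; exact: val_inj.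
  by exists t => //; apply: val_inj.
apply: connected_continuous_connected.
  by apply/connected_intervalP => x y _ _ z _.
apply: continuous_subspaceT; apply: continuous_comp_initial.
exact: stereo_continuous.
Qed.

(** Let c cut the images of two points z1 and zm of the circle. Removing from
    the circle a point q other than z1 and zm leaves a connected set that
    still contains both, so c is attained off q. Applying this once to any q
    finds a preimage z of c, and once more to q = z a second preimage,
    against injectivity. *)
Lemma no_circle_of_cut_points (X : topologicalType) :
  (forall x y : X, x <> y -> exists c : X, [/\ c <> x, c <> y &
     forall C, connected C -> C x -> C y -> C c]) ->
  ~ exists A : set X, homeomorphic (set_type A) circle.
Proof.
move=> cut [A [f [g [_ cg _ gK]]]].
pose h z := set_val (g z).
have hI : injective h by move=> z z' /val_inj /(can_inj gK).
have ch : continuous h.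
  by move=> z; apply: continuous_comp; [exact: cg|exact: initial_continuous].
have c1 : unit_circle (1 : R, 0 : R) by rewrite /unit_circle /=; lra.
have cm : unit_circle (-1 : R, 0 : R) by rewrite /unit_circle /=; lra.
have c0 : unit_circle (0 : R, 1 : R) by rewrite /unit_circle /=; lra.
pose z1 : circle := exist _ (1, 0) (mem_set c1).
pose zm : circle := exist _ (-1, 0) (mem_set cm).
pose z0 : circle := exist _ (0, 1) (mem_set c0).
have n1m : z1 <> zm by move=> /(congr1 set_val) []; lra.
have n10 : z0 <> z1 by move=> /(congr1 set_val) []; lra.
have nm0 : z0 <> zm by move=> /(congr1 set_val) []; lra.
have [|c [c1' cm' hc]] := cut (h z1) (h zm); first by move=> /hI.
have avoid q : q <> z1 -> q <> zm -> (h @` [set z | z <> q]) c.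
  move=> q1 qm; apply: hc.
  - apply: connected_continuous_connected;
    first exact: punctured_circle_connected.
    exact: continuous_subspaceT.
  - by exists z1 => // ?; apply: q1.
  - by exists zm => // ?; apply: qm.
have [z _ zc] := avoid z0 n10 nm0.
have [||z' /= z'z z'c] := avoid z.
- by move=> zz; apply: c1'; rewrite -zc zz.
- by move=> zz; apply: cm'; rewrite -zc zz.
- by apply: z'z; apply: hI; rewrite z'c.
Qed.

End Circle.

(** * Lower and upper limits *)

Section LimInfSup.
Variable R : realType.
Implicit Types u : nat -> R.

Lemma limn_sup_le u (c : R) N : bounded_fun u ->
  (forall n, (N <= n)%N -> u n <= c) -> limn_sup u <= c.
Proof.
move=> bu uc; rewrite limn_supE//.
apply: (@le_trans _ _ (sups u N)).
  apply: ge_inf; first exact: bounded_fun_has_lbound_sups.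
  by exists N.
apply: ge_sup; first by exists (u N); exists N => /=.
by move=> _ [n /= Nn <-]; exact: uc.
Qed.

Lemma limn_inf_ge u (c : R) N : bounded_fun u ->
  (forall n, (N <= n)%N -> c <= u n) -> c <= limn_inf u.
Proof.
move=> bu uc; rewrite limn_infE//.
apply: (@le_trans _ _ (infs u N)); last first.
  apply: ub_le_sup; first exact: bounded_fun_has_ubound_infs.
  by exists N.
apply: lb_le_inf; first by exists (u N); exists N => /=.
by move=> _ [n /= Nn <-]; exact: uc.
Qed.

(** If the lower and upper limits coincide, the sequence is squeezed between
    its tail infima and tail suprema. *)
Lemma limn_inf_lt_sup u : bounded_fun u -> ~ cvgn u -> limn_inf u < limn_sup u.
Proof.
move=> bu ncu; rewrite ltNge; apply/negP => si; apply: ncu.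
have ub := bounded_fun_has_ubound bu; have lb := bounded_fun_has_lbound bu.
have cs := cvg_sups_inf ub lb; have ci := cvg_infs_sup ub lb.
have iu n : infs u n <= u n.
  by apply: ge_inf; [exact: has_lbound_sdrop|exists n => /=].
have us n : u n <= sups u n.
  by apply: ub_le_sup; [exact: has_ubound_sdrop|exists n => /=].
have is_ : inf (range (sups u)) = sup (range (infs u)).
  apply/eqP; rewrite eq_le -{1}limn_supE// -{1}limn_infE// si /=.
  rewrite -(cvg_lim _ cs)// -(cvg_lim _ ci)//.
  apply: ler_lim; [by apply/cvg_ex; eexists; exact: ci|
                   by apply/cvg_ex; eexists; exact: cs|].
  by apply: nearW => n; exact: le_trans (iu n) (us n).
apply/cvg_ex; exists (sup (range (infs u))).
rewrite is_ in cs; apply: squeeze_cvgr ci cs.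
by apply: nearW => n; rewrite iu us.
Qed.

End LimInfSup.

(** * Frequencies of sets of times *)

Section Frequency.
Variable R : realType.
Implicit Types P : pred nat.

Definition freq P (n : nat) : R := (count P (iota 0 n.+1))%:R / n%:R.

Lemma close_freqE (X : metricType R) (f : X -> X) x y delta :
  close_freq f x y delta =
  freq (fun k => mdist (iter k f x) (iter k f y) < delta).
Proof.
apply/funext => n; rewrite /close_freq /freq; congr (_%:R / _).
rewrite -sum1_card -[iota 0 n.+1](_ :
  index_iota 0 n.+1 = _) ?/index_iota ?subn0//.
by rewrite -sum1_count -[iota _ _]/(index_iota 0 n.+1) big_mkord.
Qed.

Lemma freq_bounded P : bounded_fun (freq P).
Proof.
exists 2; split; first exact: num_real.
move=> M M2 n _; apply: le_trans (ltW M2).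
rewrite /freq ger0_norm ?divr_ge0//.
case: n => [|n]; first by rewrite invr0 mulr0.
rewrite ler_pdivrMr ?ltr0n// -natrM ler_nat.
by apply: leq_trans (count_size _ _) _; rewrite size_iota; lia.
Qed.

Lemma count_iota_le P m n : (count P (iota m n) <= n)%N.
Proof. by apply: leq_trans (count_size _ _) _; rewrite size_iota. Qed.

Lemma count_iota_all P m n :
  (forall i, (m <= i < m + n)%N -> P i) -> count P (iota m n) = n.
Proof.
move=> h; have : all P (iota m n) by apply/allP => i; rewrite mem_iota => /h.
by rewrite all_count size_iota => /eqP.
Qed.

Lemma count_iota_none P m n :
  (forall i, (m <= i < m + n)%N -> ~~ P i) -> count P (iota m n) = 0%N.
Proof.
move=> h; apply/eqP; rewrite -leqn0 leqNgt -has_count; apply/hasPn => i.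
by rewrite mem_iota => /h.
Qed.

(** For i > 0: i is among the last K terms of its block [2^n, 2^(n+1)). *)
Definition near_edge K i := (2 ^ (trunc_log 2 i).+1 <= i + K)%N.

(** Each of the blocks below 2^n contributes at most K times. *)
Lemma count_near_edge K n :
  (count (near_edge K) (iota 0 (2 ^ n)) <= n * K + 1)%N.
Proof.
elim: n => [|n IHn]; first by rewrite expn0 mul0n count_iota_le.
rewrite expnS mul2n -addnn iotaD count_cat add0n mulSn.
suff : (count (near_edge K) (iota (2 ^ n) (2 ^ n)) <= K)%N by lia.
case: (leqP (2 ^ n) K) => [|/ltnW] h.
  exact: leq_trans (count_iota_le _ _ _) h.
rewrite -{2}(subnK h) iotaD count_cat count_iota_none ?count_iota_le//.
move=> i hi; rewrite /near_edge (@trunc_log_eq 2 n) ?expnS//; lia.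
Qed.

Lemma sqr_le_exp2 n : ((n + 2) * (n + 2) <= 8 * 2 ^ n)%N.
Proof.
elim: n => [//|n IHn]; have := ltn_expl n (isT : (1 < 2)%N).
by rewrite expnS; nia.
Qed.

(** There are O(log N) exceptions up to N, by [count_near_edge]. *)
Lemma limn_inf_freq1 P K :
  (forall i, (K <= i)%N -> ~~ near_edge K i -> P i) -> 1 <= limn_inf (freq P).
Proof.
move=> hP; apply/ler_addgt0Pr => e e0; rewrite -lerBlDr.
pose M := Num.bound e^-1.
have Me : e^-1 < M%:R by apply: archi_boundP; rewrite invr_ge0 ltW.
have Me1 : 1 <= e * M%:R.
  by rewrite mulrC -ler_pdivrMr// div1r ltW.
(* With n0 <= n = log2 N the (n + 2)(K + 1) exceptions are at most N / M, as
   (n + 2)^2 <= 8 * 2^n. *)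
pose n0 := (8 * M * (K + 1))%N.
apply: (@limn_inf_ge _ _ _ (2 ^ n0)); first exact: freq_bounded.
move=> N Nn0; have N0 : (0 < N)%N by apply: leq_trans Nn0; rewrite expn_gt0.
pose n := trunc_log 2 N.
have /andP[nN Nn] : (2 ^ n <= N < 2 ^ n.+1)%N by apply: trunc_log_bounds.
have n0n : (n0 <= n)%N by rewrite -ltnS -(@ltn_exp2l 2)// (leq_ltn_trans Nn0).
have bad : (count (predC P) (iota 0 N.+1) <= (n + 2) * (K + 1))%N.
  have -> : ((n + 2) * (K + 1) = n.+1 * K + 1 + (K + n.+1))%N by lia.
  apply: (@leq_trans (count (predC P) (iota 0 (2 ^ n.+1)))).
    by rewrite -(subnKC Nn) iotaD count_cat leq_addr.
  apply: (@leq_trans (count (predU (near_edge K) (fun i => (i < K)%N)) (iota 0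
    (2 ^ n.+1)))).
    apply: sub_count => i /= Pi; rewrite -[X in X || _]negbK -implybE.
    by apply/implyP => ei; rewrite ltnNge; apply: contra Pi => /hP; exact.
  apply: leq_trans (_ :
    count (near_edge K) (iota 0 (2 ^ n.+1)) + count (fun i => i < K)%N (iota 0
      (2 ^ n.+1)) <= _)%N.
    by rewrite -count_predUI leq_addr.
  apply: leq_add; first exact: count_near_edge.
  apply: leq_trans (leq_addr _ _).
  case: (leqP (2 ^ n.+1) K) => [|/ltnW] h.
    exact: leq_trans (count_iota_le _ _ _) h.
  rewrite -(subnKC h) iotaD count_cat [X in (_ + X)%N]count_iota_none ?addn0
    ?count_iota_le//.
  by move=> i; lia.
have cN := count_predC P (iota 0 N.+1); rewrite size_iota in cN.
rewrite /freq ler_pdivlMr ?ltr0n//.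
have badN : (M * count (predC P) (iota 0 N.+1) <= N)%N.
  have := sqr_le_exp2 n; rewrite /n0 in n0n.
  have : (8 * M * (K + 1) * (n + 2) <= (n + 2) * (n + 2))%N.
    by apply: leq_mul => //; lia.
  have : (M * count (predC P) (iota 0 N.+1) <= M * ((n + 2) * (K + 1)))%N.
    by rewrite leq_mul2l bad orbT.
  nia.
have : (count (predC P) (iota 0 N.+1))%:R <= e * N%:R.
  apply: (@le_trans _ _ (e * M%:R * (count (predC P) (iota 0 N.+1))%:R)).
    by rewrite -[leLHS]mul1r ler_wpM2r.
  by rewrite -mulrA ler_pM2l// -natrM ler_nat.
have : (count P (iota 0 N.+1))%:R + (count (predC P) (iota 0 N.+1))%:R = N%:R
  + 1 :> R.
  by rewrite -natrD cN -natr1.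
nra.
Qed.

Lemma logn2_odd j s : logn 2 (2 ^ j * s.*2.+1) = j.
Proof.
by rewrite lognM ?expn_gt0// pfactorK// lognE /= dvdn2 /= odd_double addn0.
Qed.

(** The integers n with exponent of 2 equal to j form an arithmetic
    progression of difference 2^(j+1). *)
Lemma exists_logn2 j q : (2 ^ j < q)%N ->
  exists m, [/\ logn 2 m = j, (m < q)%N & (q <= m + 2 ^ j.+1)%N].
Proof.
move=> jq; pose s := ((q - 1 - 2 ^ j) %/ 2 ^ j.+1)%N.
have p0 : (0 < 2 ^ j)%N by rewrite expn_gt0.
have := divn_eq (q - 1 - 2 ^ j) (2 ^ j.+1).
have : ((q - 1 - 2 ^ j) %% 2 ^ j.+1 < 2 ^ j.+1)%N by rewrite ltn_mod expn_gt0.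
rewrite -/s => h1 h2; exists (2 ^ j * (s.*2.+1))%N; split.
- exact: logn2_odd.
- by rewrite expnS in h1 h2; nia.
- by rewrite expnS in h1 h2 *; nia.
Qed.

(** Up to N there is a complete block n with exponent j and 2^n of order
    2^(-2^(j+1)) N at least, and P fails on most of it. *)
Lemma limn_sup_freq_lt1 P j K :
  (forall n i, logn 2 n = j -> (K <= i)%N -> (2 ^ n <= i)%N ->
     (i + K < 2 ^ n.+1)%N -> ~~ P i) ->
  limn_sup (freq P) < 1.
Proof.
move=> hP; pose L := (2 ^ j.+1)%N; pose c : R := 1 - (2 ^ (L + 3))%:R^-1.
suff : limn_sup (freq P) <= c.
  move=> h; apply: le_lt_trans h _; rewrite /c ltrBlDr ltrDl invr_gt0 ltr0n.
  by rewrite expn_gt0.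
(* A time N >= 2^q0 leaves room below it for a complete block m with
   exponent j and 2^m >= 2 K + 2. *)
pose q0 := (2 ^ j + L + K.*2 + 2)%N.
apply: (@limn_sup_le _ _ _ (2 ^ q0)); first exact: freq_bounded.
move=> N Nq0; have N0 : (0 < N)%N by apply: leq_trans Nq0; rewrite expn_gt0.
pose q := trunc_log 2 N.+1.
have /andP[qN Nq] : (2 ^ q <= N.+1 < 2 ^ q.+1)%N by apply: trunc_log_bounds.
have q0q : (q0 <= q)%N by rewrite -ltnS -(@ltn_exp2l 2)//; lia.
have [|m [mj mq qm]] := @exists_logn2 j q; first by rewrite /q0 in q0q; lia.
rewrite -/L in qm.
have Km : (K.*2 + 2 <= m)%N by rewrite /q0 in q0q; lia.
have m2 := ltn_expl m (isT : (1 < 2)%N).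
have K2 : (K <= 2 ^ m)%N by lia.
have bad : (2 ^ m - K <= count (predC P) (iota 0 N.+1))%N.
  have h : (2 ^ m + (2 ^ m - K) <= N.+1)%N.
    apply: leq_trans qN; apply: (@leq_trans (2 ^ m.+1));
      last by rewrite leq_exp2l.
    by rewrite expnS; lia.
  rewrite -(subnKC h) !iotaD !count_cat add0n.
  rewrite [X in (_ + X + _)%N]count_iota_all; first lia.
  by move=> i /= hi; apply: (hP m) => //; rewrite ?expnS; lia.
have cN := count_predC P (iota 0 N.+1); rewrite size_iota in cN.
have NL : (N.+1 < 2 ^ m * 2 ^ L * 2)%N.
  apply: leq_trans Nq _; rewrite -expnD -[X in (_ <= _ * X)%N]expn1 -expnD.
  by rewrite leq_exp2l; lia.
have key : (2 ^ (L + 3) * count P (iota 0 N.+1) + N <= 2 ^ (L + 3) * N)%N.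
  rewrite expnD; move: bad cN NL; set B := count (predC P) _;
    set C := count P _.
  move: (2 ^ L)%N (2 ^ m)%N m2 Km => l t; move=> *; nia.
have p0 : 0 < (2 ^ (L + 3))%:R :> R by rewrite ltr0n expn_gt0.
rewrite /freq ler_pdivrMr ?ltr0n// -(ler_pM2l p0) /c mulrBl mul1r mulrBr.
rewrite mulrA divff ?gt_eqF// mul1r lerBrDr -natrM -natrM -natrD ler_nat.
exact: key.
Qed.

(** Write T = 2^n, and u, u' for the frequencies at times T - 1 and 2T - 1.
    Since P is constantly A(v(n)) on the block between, of length T,
    u' (2T - 1) = u (T - 1) + A(v(n)) T; if u and u' are both near l, so is
    A(v(n)), which however is infinitely often 0 and infinitely often 1. *)
Lemma freq_dyadic_diverges P (A : pred nat) j0 j1 :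
  (forall i, (0 < i)%N -> P i = A (logn 2 (trunc_log 2 i))) ->
  ~~ A j0 -> A j1 -> ~ cvgn (freq P).
Proof.
move=> PA Aj0 Aj1 /cvg_ex[l /cvgr_dist_lt cl].
have h7 : 0 < 1 / 7 :> R by lra.
have [N _ hN] := cl _ h7.
have step n : (N < n)%N -> `|l - (A (logn 2 n))%:R| < 3 / 7.
  move=> Nn; have n2 := ltn_expl n (isT : (1 < 2)%N).
  have p0 : (0 < 2 ^ n)%N by rewrite expn_gt0.
  have p1 : (0 < 2 ^ n.+1)%N by rewrite expn_gt0.
  have h1 : `|l - freq P (2 ^ n).-1| < 1 / 7 by apply: hN => /=; lia.
  have h2 : `|l - freq P (2 ^ n.+1).-1| < 1 / 7.
    by apply: hN => /=; rewrite expnS; lia.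
  pose T : R := (2 ^ n)%:R; have T2 : 2 <= T by rewrite ler_nat; lia.
  have E1 : freq P (2 ^ n).-1 * (T - 1) = (count P (iota 0 (2 ^ n)))%:R.
    rewrite /freq prednK// -subn1 natrB// divfK// -/T; apply/eqP; lra.
  have E2 : freq P (2 ^ n.+1).-1 * (2 * T - 1) = (count P (iota 0 (2 ^
    n.+1)))%:R.
    rewrite /freq prednK// -subn1 natrB// expnS natrM divfK// -/T.
    by apply/eqP; lra.
  have E3 : (count P (iota 0 (2 ^ n.+1)))%:R =
      (count P (iota 0 (2 ^ n)))%:R + (A (logn 2 n))%:R * T :> R.
    rewrite expnS mul2n -addnn iotaD count_cat natrD add0n; congr (_ + _).
    have PAn i : (2 ^ n <= i < 2 ^ n + 2 ^ n)%N -> P i = A (logn 2 n).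
      rewrite addnn -mul2n -expnS => hi.
      by rewrite PA ?(@trunc_log_eq 2 n)//; lia.
    case An : (A (logn 2 n)).
      by rewrite count_iota_all ?mul1r// => i /PAn ->.
    by rewrite count_iota_none ?mul0r// => i /PAn ->; rewrite An.
  move: h1 h2 E1 E2; rewrite E3 !ltr_norml.
  move: (freq P _) (freq P _) (count P _)%:R (A _)%:R => u u' c a.
  move=> /andP[u1 u2] /andP[v1 v2] E1 E2; clearbody T.
  have [T1 T3 Tp] : [/\ 0 < T - 1, 0 < 2 * T - 1 & 0 < T] by split; lra.
  have w1 : 0 < (1 / 7 - (l - u)) * (T - 1) by rewrite mulr_gt0// subr_gt0.
  have w2 : 0 < (1 / 7 + (l - u)) * (T - 1) by rewrite mulr_gt0//
    -ltrBlDl sub0r.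
  have w3 : 0 < (1 / 7 - (l - u')) * (2 * T - 1) by rewrite mulr_gt0// subr_gt0.
  have w4 : 0 < (1 / 7 + (l - u')) * (2 * T - 1).
    by rewrite mulr_gt0// -ltrBlDl sub0r.
  by apply/andP; split; rewrite -(ltr_pM2l Tp); lra.
have b0 j : (N < 2 ^ j * N.*2.+1)%N.
  by have : (0 < 2 ^ j)%N; [rewrite expn_gt0|nia].
have := step _ (b0 j0); have := step _ (b0 j1);
  rewrite !logn2_odd Aj1 (negbTE Aj0) /= !ltr_norml; lra.
Qed.

End Frequency.

(** * A subshift coded on dyadic blocks *)

Section Sequences.
Implicit Types (a b xi eta : nat -> bool).

Definition shift k xi : nat -> bool := fun i => xi (i + k)%N.

(** The exponent v(n) of 2 in the index n of the dyadic block of i. *)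
Definition block_code i := logn 2 (trunc_log 2 i).

Definition blocks a : nat -> bool := fun i => a (block_code i).

(** Constant sequences and sequences that switch value once: the limits of
    shifts of codes by amounts tending to infinity. *)
Definition one_switch xi := forall i j l, (i <= j <= l)%N ->
  xi i = xi l -> xi j = xi i.

Definition leaves : set cantor_space :=
  [set xi | (exists k a, xi = shift k (blocks a)) \/ one_switch xi].

Definition agree n xi eta := forall i, (i < n)%N -> xi i = eta i.

Lemma shift_leaves xi : leaves xi -> leaves (shift 1 xi).
Proof.
move=> [[k [a ->]]|h]; [left|right].
  by exists k.+1, a; apply/funext => i; rewrite /shift -addnA add1n.
by move=> i j l ijl; apply: h; lia.
Qed.

Lemma constant_leaves (c : bool) : leaves (fun=> c).
Proof. by right. Qed.

Lemma blocks_leaves a : leaves (blocks a).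
Proof.
left; exists 0%N, a; apply/funext => i.
by rewrite /shift addn0.
Qed.

(** xi reads like the code of [a] away from the ends of blocks. Unlike being
    equal to the code this is insensitive to a shift of time. *)
Definition traces xi a := exists K, forall i,
  (K <= i)%N -> ~~ near_edge K i -> xi i = a (block_code i).

Lemma trunc_log2_add K i k : (0 < i)%N -> ~~ near_edge K i -> (k <= K)%N ->
  trunc_log 2 (i + k) = trunc_log 2 i.
Proof.
move=> i0; rewrite /near_edge -ltnNge => h kK; apply: trunc_log_eq => //.
by have /andP[] := trunc_log_bounds (isT : (1 < 2)%N) i0; lia.
Qed.

(** A shift by k only spoils the last k terms of each block, and a sequence
    that is eventually c follows the code of the constant sequence c. *)
Lemma leaves_trace xi : leaves xi -> exists a, traces xi a.
Proof.
move=> [[k [a ->]]|h].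
  exists a, k.+1 => i Ki ei; rewrite /shift /blocks /block_code.
  by rewrite (trunc_log2_add _ ei)//; lia.
have [e|/existsNP[j /eqP hj]] := pselect (forall j, xi j = xi 0%N).
  by exists (fun=> xi 0%N), 0%N => i _ _; exact: e.
exists (fun=> xi j), j => l jl _; apply/eqP; apply: contraNT hj => lj.
have := h 0%N j l jl; move: lj.
by case: (xi l) (xi j) (xi 0%N) => [] [] [] // _ /(_ erefl).
Qed.

(** A window of length at most k that starts at time k or later contains at
    most one power of 2, other than its first time, so at most one switch. *)
Lemma switch_window k a i j l : (i <= j <= l)%N -> (l <= k)%N ->
  shift k (blocks a) i = shift k (blocks a) l ->
  shift k (blocks a) j = shift k (blocks a) i.
Proof.
move=> /andP[ij jl] lk; rewrite /shift /blocks /block_code.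
have [k0|k0] := posnP k;
  first by have [-> -> ->] : [/\ i = 0, j = 0 & l = 0]%N by split; lia.
have le_log m n : (m <= n)%N -> (trunc_log 2 m <= trunc_log 2 n)%N.
  exact: leq_trunc_log.
have h : (trunc_log 2 (l + k) <= (trunc_log 2 (i + k)).+1)%N.
  rewrite -ltnS -(@ltn_exp2l 2)//.
  have [ik0 lk0] : (0 < i + k)%N /\ (0 < l + k)%N by split; lia.
  have /andP[_ h1] := trunc_log_bounds (isT : (1 < 2)%N) ik0.
  have /andP[h2 _] := trunc_log_bounds (isT : (1 < 2)%N) lk0.
  by rewrite expnS; lia.
have h1 : (trunc_log 2 (i + k) <= trunc_log 2 (j + k))%N by apply: le_log; lia.
have h2 : (trunc_log 2 (j + k) <= trunc_log 2 (l + k))%N by apply: le_log; lia.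
have [->//|->//] : trunc_log 2 (j + k) = trunc_log 2 (i + k) \/
  trunc_log 2 (j + k) = trunc_log 2 (l + k) by lia.
Qed.

Lemma nbhs_agree (xi : cantor_space) n :
  nbhs xi [set eta : cantor_space | agree n xi eta].
Proof.
elim: n => [|n IHn]; first by apply: filterE => eta i.
have hn : nbhs xi [set eta : cantor_space | eta n = xi n].
  apply: (@proj_continuous nat (fun=> bool) n xi [set xi n]).
  exact: discrete_set1.
apply: filterS2 IHn hn => eta h1 h2 i;
  rewrite ltnS leq_eqVlt => /orP[/eqP->//|].
exact: h1.
Qed.

Lemma closure_agree (A : set cantor_space) (xi : cantor_space) n :
  closure A xi -> exists2 eta : cantor_space, A eta & agree n xi eta.
Proof. by move=> /(_ _ (nbhs_agree xi n)) [eta [Aeta h]]; exists eta. Qed.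

(** Let xi be a limit of leaves. If the shifts k needed to approximate xi are
    unbounded, or one-switch sequences are used, then every finite window of
    xi has at most one switch. Otherwise the pigeonhole principle yields a
    single k that serves for all approximations, and the code can be read
    off xi, its j-th bit at some time whose block has exponent j. *)
Lemma leaves_closed : closed leaves.
Proof.
move=> xi cxi.
have [h|/existsNP[n0 hn0]] := pselect (forall n, exists eta, agree n xi eta /\
    (one_switch eta \/ exists k a, (n <= k)%N /\ eta = shift k (blocks a))).
  right => i j l ijl.
  have [eta [ag ho]] := h l.+1; have /andP[ij jl] := ijl.
  rewrite !ag ?ltnS ?(leq_trans ij jl)//.
  by case: ho => [ho|[k [a [lk ->]]]]; [exact: ho|apply: switch_window; lia].
left.
have h n : (n0 <= n)%N ->
  exists k a, (k < n0)%N /\ agree n xi (shift k (blocks a)).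
  move=> n0n; have [eta [[k [a etaE]]|ho] ag] := closure_agree n cxi.
    exists k, a; rewrite -etaE; split=> //; rewrite ltnNge; apply/negP => kn0.
    apply: hn0; exists eta; split; last by right; exists k, a.
    by move=> i i0; apply: ag; lia.
  exfalso; apply: hn0; exists eta; split; last by left.
  by move=> i i0; apply: ag; lia.
have [k hk] : exists k, forall n, exists a, agree n xi (shift k (blocks a)).
  apply: contrapT => /forallNP nk.
  have /choice[N hN] : forall k, exists n, forall a, ~ agree n xi (shift k
    (blocks a)).
    by move=> k; have /existsNP[n /forallNP hn] := nk k; exists n.
  (* If each shift k < n0 failed at some precision N k, all of them would fail
     at the precision M. *)
  pose M := (n0 + \sum_(k < n0) N k)%N.
  have [k [a [kn0 ag]]] := h M (leq_addr _ _).
  apply: (hN k a) => i ik; apply: ag; apply: leq_trans ik _.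
  by rewrite /M (bigD1 (Ordinal kn0))//=; lia.
(* A time in a block with exponent j; the odd factor 2 k + 1 makes it at
   least k, so that it is visible in a shift by k. *)
pose pos j := (2 ^ (2 ^ j * k.*2.+1))%N.
have kpos j : (k <= pos j)%N.
  have := ltn_expl (2 ^ j * k.*2.+1) (isT : (1 < 2)%N).
  by have : (0 < 2 ^ j)%N; [rewrite expn_gt0|rewrite /pos; nia].
have code_pos j : block_code (pos j) = j.
  by rewrite /block_code trunc_expnK// logn2_odd.
exists k, (fun j => xi (pos j - k)%N); apply/funext => i.
rewrite {1}/shift /blocks; set j := block_code (i + k).
have [a ag] := hk (maxn i (pos j - k)).+1.
rewrite !ag ?ltnS ?leq_maxl ?leq_maxr//.
by rewrite /shift /blocks subnK// code_pos.
Qed.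

Lemma leaves_compact : compact leaves.
Proof.
exact: subclosed_compact leaves_closed cantor_space_compact (@subsetT _ _).
Qed.

End Sequences.

(** * The tree spanned by the subshift *)

Section SequenceMerging.
Variable R : realType.
Implicit Types (xi eta : nat -> bool).

Definition merge_seq xi eta : R :=
  if pselect (exists n, xi n != eta n) is left e then 1 - 2 ^- ex_minn e else 1.

Variant merge_spec xi eta : R -> Prop :=
| MergeEq of xi = eta : merge_spec xi eta 1
| MergeNeq n of agree n xi eta & xi n <> eta n : merge_spec xi eta (1 - 2 ^- n).

Lemma merge_seqP xi eta : merge_spec xi eta (merge_seq xi eta).
Proof.
rewrite /merge_seq; case: pselect => [e|ne].
  case: ex_minnP => n /eqP nn min; apply: MergeNeq => // i lin.
  by apply/eqP; apply: contraTT lin => /min; rewrite -leqNgt.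
apply: MergeEq; apply/funext => n; apply: contrapT => /eqP h.
by apply: ne; exists n.
Qed.

Lemma exp2_gt0 n : 0 < 2 ^- n :> R.
Proof. by rewrite invr_gt0 exprn_gt0. Qed.

Lemma exp2_half n : 2 * 2 ^- n.+1 = 2 ^- n :> R.
Proof. by rewrite exprS invfM mulrA divff ?mul1r// pnatr_eq0. Qed.

Lemma exp2_anti m n : (m <= n)%N -> 2 ^- n <= 2 ^- m :> R.
Proof.
by move=> mn; rewrite lef_pV2 ?posrE ?exprn_gt0// ler_weXn2l// ler1n.
Qed.

Lemma exp2_small (e : R) : 0 < e -> exists n, 2 ^- n < e.
Proof.
move=> e0; exists (Num.bound e^-1);
  rewrite -[ltRHS]invrK ltf_pV2 ?posrE ?exprn_gt0 ?invr_gt0//.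
apply: (@lt_le_trans _ _ (Num.bound e^-1)%:R).
  by apply: archi_boundP; rewrite invr_ge0 ltW.
by rewrite -natrX ler_nat ltnW// ltn_expl.
Qed.

Lemma merge_seq_ge n xi eta : agree n xi eta -> 1 - 2 ^- n <= merge_seq xi eta.
Proof.
case: merge_seqP => [_ _|m _ nm ag]; first by have := exp2_gt0 n; lra.
have : (n <= m)%N by rewrite leqNgt; apply/negP => /ag.
by move=> /exp2_anti; lra.
Qed.

Lemma merge_seq_le n xi eta : xi n <> eta n -> merge_seq xi eta <= 1 - 2 ^- n.
Proof.
case: merge_seqP => [->//|m ag _ nn].
have : (m <= n)%N by rewrite leqNgt; apply/negP => /ag.
by move=> /exp2_anti; lra.
Qed.

Lemma merge_seq_ge0 xi eta : 0 <= merge_seq xi eta.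
Proof.
by apply: le_trans (@merge_seq_ge 0 _ _ _); rewrite ?expr0 ?invr1 ?subrr.
Qed.

Lemma merge_seq_le1 xi eta : merge_seq xi eta <= 1.
Proof. by case: merge_seqP => // n _ _; have := exp2_gt0 n; lra. Qed.

Lemma merge_seq_refl xi : merge_seq xi xi = 1.
Proof. by case: merge_seqP => // n _ /(_ erefl). Qed.

Lemma merge_seq_sym xi eta : merge_seq xi eta = merge_seq eta xi.
Proof.
wlog suff h : xi eta / merge_seq xi eta <= merge_seq eta xi.
  by apply/eqP; rewrite eq_le !h.
case: merge_seqP => [->|n ag _]; first by rewrite merge_seq_refl.
by apply: merge_seq_ge => i /ag.
Qed.

Lemma merge_seq_ultra eta xi zeta :
  Num.min (merge_seq xi eta) (merge_seq eta zeta) <= merge_seq xi zeta.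
Proof.
case: (merge_seqP xi zeta) => [_|n _ nn]; first by rewrite ge_min merge_seq_le1.
rewrite ge_min; have [e|e] := eqVneq (xi n) (eta n).
  by rewrite orbC merge_seq_le// -e.
by rewrite merge_seq_le//; apply/eqP.
Qed.

(** This is the reason for the heights 1 - 2^-n: shifting lowers the first
    index of disagreement by one, and t |-> 2t - 1 takes 1 - 2^-(n+1) to
    1 - 2^-n. *)
Lemma merge_seq_shift xi eta :
  2 * merge_seq xi eta - 1 <= merge_seq (shift 1 xi) (shift 1 eta).
Proof.
case: (merge_seqP xi eta) => [->|[|n] ag _].
- by rewrite merge_seq_refl; lra.
- by rewrite expr0 invr1; have := merge_seq_ge0 (shift 1 xi) (shift 1 eta); lra.
- apply: le_trans (@merge_seq_ge n _ _ _); last by move=> i lin; apply: ag;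
  rewrite addn1.
  by have := exp2_half n; lra.
Qed.

Definition seq_merging : merging R :=
  @Merging R (set_type leaves : choiceType)
    (fun x y => merge_seq (set_val x) (set_val y))
    (fun _ _ => merge_seq_ge0 _ _) (fun _ => merge_seq_refl _)
    (fun _ _ => merge_seq_sym _ _) (fun _ _ _ => merge_seq_ultra _ _ _).

Definition constant_leaf (c : bool) : leaf seq_merging :=
  exist _ (fun=> c) (mem_set (constant_leaves c)).

Definition blocks_leaf (a : nat -> bool) : leaf seq_merging :=
  exist _ (blocks a) (mem_set (blocks_leaves a)).

Definition system := tree seq_merging.

Definition leaf_shift (x : leaf seq_merging) : leaf seq_merging :=
  exist _ (shift 1 (set_val x)) (mem_set (shift_leaves (set_valP x))).

(** Negative values need no special care as [height] clamps them to 0. *)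
Definition stem_shift (p : stem seq_merging) : stem seq_merging :=
  (leaf_shift p.1, 2 * height p - 1).

Definition tree_shift (x : system) : system := at_stem (stem_shift (repr x)).

Lemma height_stem_shift p :
  height (stem_shift p) = Num.max 0 (2 * height p - 1).
Proof.
have := height_ge0 p; have := height_le1 p; rewrite {3}/height /= => h1 h0.
by rewrite (min_r (_ : _ <= 1)); last lra.
Qed.

(** Both the heights and, by [merge_seq_shift], a lower bound of the meet are
    transformed by the 2-Lipschitz map t |-> max(0, 2t - 1). *)
Lemma stem_dist_shift p q :
  stem_dist (stem_shift p) (stem_shift q) <= 2 * stem_dist p q.
Proof.
have hm : Num.max 0 (2 * meet p q - 1) <= meet (stem_shift p) (stem_shift q).
  rewrite ge_max meet_ge0 /= [leRHS]/meet !le_min !height_stem_shift !le_max.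
  apply/andP; split.
    have := meet_lel p q; have := meet_ler p q.
    by move=> ? ?; apply/andP; split; apply/orP; right; lra.
  apply: le_trans (merge_seq_shift _ _).
  have : meet p q <= merge p.1 q.1 by rewrite /meet ge_min lexx orbT.
  by rewrite /=; lra.
rewrite /stem_dist !height_stem_shift; have := meet_lel p q;
  have := meet_ler p q.
move: hm; move: (meet (stem_shift p) _) (meet p q) (height p) (height q).
move=> m' m h k; rewrite ge_max => /andP[? ?] ? ?.
by case: (leP 0 (2 * h - 1)); case: (leP 0 (2 * k - 1)); lra.
Qed.

Lemma tree_shift_stem p : tree_shift (at_stem p) = at_stem (stem_shift p).
Proof.
apply/at_stem_eq/eqP; rewrite eq_le stem_dist_ge0 andbT.
apply: le_trans (stem_dist_shift _ _) _.
suff -> : stem_dist (repr (at_stem p)) p = 0 by rewrite mulr0.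
by apply/at_stem_eq; rewrite at_stem_repr.
Qed.

Lemma tree_shift_continuous : continuous tree_shift.
Proof.
apply: (@lipschitz_continuous R system system 2) => // x y.
by rewrite /tree_shift mdist_tree; exact: stem_dist_shift.
Qed.

Lemma seq_tree_compact : compact [set: system].
Proof.
pose l (xi : cantor_space) :
  leaf seq_merging := insubd (constant_leaf false) xi.
have lE xi : leaves xi -> set_val (l xi) = xi.
  by move=> h; rewrite /l set_valE insubdK//; exact: mem_set.
apply: (@tree_compact _ _ _ leaves l leaves_compact).
  move=> x; exists (set_val x); first exact: set_valP.
  by apply: val_inj; rewrite -set_valE lE//; exact: set_valP.
move=> xi e xiL e0.
have [n ne] := exp2_small e0.
have : nbhs xi [set eta : cantor_space | agree n xi eta] by exact: nbhs_agree.
apply: filterS => eta ag etaL /=; rewrite !lE//.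
by apply: le_trans (merge_seq_ge ag); lra.
Qed.

Lemma seq_tree_dendrite : dendrite system.
Proof.
split; [split; [|exact: seq_tree_compact|exact: tree_connected]| |].
- by exists (at_stem (constant_leaf false, 0)).
- exact: tree_locally_connected.
- apply: no_circle_of_cut_points; exact: tree_cut.
Qed.
End SequenceMerging.

(** * Distributional chaos in the tree *)

Section Dynamics.
Variable R : realType.
Local Notation stem := (stem (seq_merging R)).
Local Notation leaf := (leaf (seq_merging R)).
Implicit Types (p q : stem) (l : leaf) (a b xi eta : nat -> bool).

Lemma iter_tree_shift k p :
  iter k (@tree_shift R) (at_stem p) = at_stem (iter k (@stem_shift R) p).
Proof. by elim: k => // k IHk; rewrite !iterS IHk tree_shift_stem. Qed.

Lemma height_top l : height (l, 1) = 1.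
Proof. by rewrite height_id// ler01 lexx. Qed.

Lemma iter_stem_shift_top k l :
  iter k (@stem_shift R) (l, 1) = (iter k (@leaf_shift R) l, 1).
Proof.
elim: k => // k IHk; rewrite !iterS IHk /stem_shift height_top /=.
by congr (_, _); lra.
Qed.

Lemma val_leaf_shift l : set_val (leaf_shift l) = shift 1 (set_val l).
Proof. by []. Qed.

Lemma val_iter_leaf_shift k l i :
  set_val (iter k (@leaf_shift R) l) i = set_val l (i + k)%N.
Proof.
elim: k i => [|k IHk] i; first by rewrite addn0.
by rewrite iterS val_leaf_shift /shift IHk addn1 addSnnS.
Qed.

Lemma stem_dist_top l l' : stem_dist (l, 1) (l', 1) =
  2 - 2 * merge_seq R (set_val l) (set_val l').
Proof.
rewrite /stem_dist /meet !height_top minxx /= min_r ?merge_seq_le1//; lra.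
Qed.

Lemma height_iter_stem_shift k p :
  height (iter k (@stem_shift R) p) = Num.max 0 (1 - 2 ^+ k * (1 - height p)).
Proof.
elim: k => [|k IHk].
  by rewrite expr0 mul1r opprB addrC subrK max_r// height_ge0.
rewrite iterS height_stem_shift IHk exprS -mulrA; set y := _ * (_ - _).
case: (leP 0 (1 - y)) => hy; first by congr Num.max; lra.
by rewrite mulr0 !max_l//; lra.
Qed.

(** The distance to the top level doubles at every step until it is 1. *)
Lemma height_eventually0 p : height p < 1 ->
  exists N, forall k, (N <= k)%N -> height (iter k (@stem_shift R) p) = 0.
Proof.
rewrite -subr_gt0 => h1; have [N hN] := exp2_small h1.
exists N => k Nk; rewrite height_iter_stem_shift max_l// subr_le0.
have k2 : 0 < 2 ^+ k :> R by rewrite exprn_gt0.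
have : 2 ^- k <= 1 - height p by apply: le_trans (exp2_anti R Nk) (ltW hN).
by rewrite -(ler_pM2l k2) divff ?gt_eqF.
Qed.

Lemma stem_dist_root p q : height p = 0 -> stem_dist p q = height q.
Proof.
move=> p0; have := meet_lel p q; have := meet_ge0 p q.
by rewrite /stem_dist p0; lra.
Qed.

Lemma height_iter_top k p : height p = 1 ->
  height (iter k (@stem_shift R) p) = 1.
Proof.
by move=> p1; rewrite height_iter_stem_shift p1 subrr mulr0 subr0 max_r// ler01.
Qed.

Definition close p q (delta : R) : pred nat := fun k =>
  stem_dist (iter k (@stem_shift R) p) (iter k (@stem_shift R) q) < delta.

Lemma close_freq_stem p q delta :
  close_freq (@tree_shift R) (at_stem p) (at_stem q) delta =
  freq R (close p q delta).
Proof.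
rewrite close_freqE; congr freq; apply/funext => k.
by rewrite !iter_tree_shift mdist_tree.
Qed.

Lemma close_top_agree n k l l' (delta : R) : 2 * 2 ^- n < delta ->
  agree n (shift k (set_val l)) (shift k (set_val l')) ->
    close (l, 1) (l', 1) delta k.
Proof.
move=> nd ag; rewrite /close !iter_stem_shift_top stem_dist_top.
apply: le_lt_trans nd.
have : agree n (set_val (iter k (@leaf_shift R) l)) (set_val (iter k
  (@leaf_shift R) l')).
  by move=> i /ag; rewrite !val_iter_leaf_shift.
by move=> /(merge_seq_ge R); lra.
Qed.

Lemma close_top_eq k l l' (delta : R) : delta <= 2 ->
  close (l, 1) (l', 1) delta k -> set_val l k = set_val l' k.
Proof.
move=> d2; rewrite /close !iter_stem_shift_top stem_dist_top => h.
apply: contrapT => kk.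
have : set_val (iter k (@leaf_shift R) l) 0%N <> set_val (iter k (@leaf_shift
  R) l') 0%N.
  by rewrite !val_iter_leaf_shift.
by move=> /(merge_seq_le R); rewrite expr0 invr1; lra.
Qed.

(** Windows of length n cross a block boundary only near the end of a
    block. *)
Lemma traces_agree xi eta a n : traces xi a -> traces eta a ->
  exists K, forall i, (K <= i)%N -> ~~ near_edge K i ->
    agree n (shift i xi) (shift i eta).
Proof.
move=> [K h] [K' h']; exists (K + K' + n).+1 => i Ki ei t tn.
have e : trunc_log 2 (i + t) = trunc_log 2 i.
  by apply: trunc_log2_add ei _; lia.
rewrite /shift addnC h ?h' //; rewrite ?/near_edge ?e; move: ei;
  rewrite /near_edge; lia.
Qed.

Lemma Phi_same_trace l l' a (delta : R) : traces (set_val l) a ->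
  traces (set_val l') a -> 0 < delta ->
  1 <= limn_inf (freq R (close (l, 1) (l', 1) delta)).
Proof.
move=> la la' d0; have [|n nd] := @exp2_small R (delta / 2); first lra.
have [K hK] := traces_agree n la la'.
apply: (@limn_inf_freq1 _ _ K) => i Ki ei.
by apply: close_top_agree (hK i Ki ei); lra.
Qed.

Lemma Phi_star_distinct_traces l l' a b (delta : R) : traces (set_val l) a ->
  traces (set_val l') b -> a <> b -> delta <= 2 ->
  limn_sup (freq R (close (l, 1) (l', 1) delta)) < 1.
Proof.
move=> [K h] [K' h'] ab d2.
have [j jab] : exists j, a j <> b j.
  by apply: contrapT => /forallNP e; apply: ab; apply/funext => j;
    apply: contrapT.
apply: (@limn_sup_freq_lt1 _ _ j (K + K')) => n i nj Ki ni iK.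
have ti : trunc_log 2 i = n by apply: trunc_log_eq => //; lia.
apply/negP => /close_top_eq => /(_ d2).
by rewrite h ?h' /block_code ?ti ?nj// /near_edge ?ti; lia.
Qed.

(** Points below the top level reach the root. If both do, they are eventually
    equal; if only one does, the distance is eventually 1; and for two leaves
    the proximity has either full lower density or upper density less than 1,
    according to whether they follow the same code. *)
Lemma no_DC2_pair x y : ~ DC2_pair (@tree_shift R) x y.
Proof.
rewrite -(at_stem_repr x) -(at_stem_repr y).
move: (repr x) (repr y) => p q [star [eps [e0 ed]]].
have {ed}high delta : 0 < delta -> delta <= eps ->
    ~ limn_sup (freq R (close p q delta)) < 1.
  move=> d0 de; rewrite -close_freq_stem -/(Phi_star _ _ _ _) star ?ltxx//.
  exact: le_trans de ed.
rewrite /Phi close_freq_stem; apply/negP; rewrite -leNgt.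
pose delta := Num.min eps 1.
have [d0 de d1] : [/\ 0 < delta, delta <= eps & delta <= 1].
  by rewrite /delta lt_min e0 ltr01 !ge_min !lexx orbT.
have {high}high := high _ d0 de.
have far N : (forall k, (N <= k)%N -> 1 <= stem_dist
    (iter k (@stem_shift R) p) (iter k (@stem_shift R) q)) -> False.
  move=> hN; apply: high; apply: (@limn_sup_freq_lt1 _ _ 0 N) => n i _ Ni _ _.
  by rewrite -leNgt (le_trans d1)// hN.
have [p1|p1] := ltP (height p) 1; have [q1|q1] := ltP (height q) 1.
- have [[N hN] [M hM]] := (height_eventually0 p1, height_eventually0 q1).
  apply: (@limn_inf_freq1 _ _ (N + M)) => k Nk _.
  by rewrite /close stem_dist_root ?hN ?hM//; lia.
- have q1' : height q = 1 by apply/eqP; rewrite eq_le height_le1.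
  have [N hN] := height_eventually0 p1; exfalso; apply: (far N) => k Nk.
  by rewrite stem_dist_root ?hN// height_iter_top.
- have p1' : height p = 1 by apply/eqP; rewrite eq_le height_le1.
  have [N hN] := height_eventually0 q1; exfalso; apply: (far N) => k Nk.
  by rewrite stem_dist_sym stem_dist_root ?hN// height_iter_top.
have top (r : stem) : 1 <= height r -> at_stem r = at_stem (r.1, 1).
  move=> r1; rewrite -at_stem_height; congr (at_stem (_, _)).
  by apply/eqP; rewrite eq_le height_le1.
have E d : close p q d = close (p.1, 1) (q.1, 1) d.
  apply/funext => k; rewrite /close -!mdist_tree -!iter_tree_shift.
  by rewrite (top p)// (top q).
rewrite E; move: high; rewrite E.
have [a pa] := leaves_trace (set_valP p.1).
have [b qb] := leaves_trace (set_valP q.1).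
have [ab|ab] := pselect (a = b); last first.
  by case; apply: (Phi_star_distinct_traces pa qb ab); lra.
by move=> _; apply: Phi_same_trace e0; [exact: pa|rewrite ab].
Qed.

(** Leaves that differ at index 0 are at distance 2, other pairs of leaves at
    distance at most 1. So for every delta in (1, 2) being close means
    agreeing at time 0, and the frequency of this diverges. The common bit at
    0 provides the blocks of agreement. *)
Lemma DC3_blocks a b : a 0%N = b 0%N -> a <> b ->
  DC3_pair (@tree_shift R) (at_stem (blocks_leaf R a, 1)) (at_stem
    (blocks_leaf R b, 1)).
Proof.
move=> ab0 ab; exists 1, 2; split=> //; [lra| |].
  apply: ub_le_sup.
    by exists 2 => _ [[u v] _ <-]; exact: tree_dist_le2.
  exists (at_stem (constant_leaf R false, 1), at_stem (constant_leaf R true,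
    1)) => //=.
  rewrite mdist_tree stem_dist_top (_ : merge_seq _ _ _ = 0) ?mulr0 ?subr0//.
  apply/eqP; rewrite eq_le merge_seq_ge0 andbT.
  by apply: le_trans (@merge_seq_le _ 0 _ _ _) _; rewrite // expr0 invr1 subrr.
move=> delta d1 d2; rewrite /Phi /Phi_star close_freq_stem.
apply: limn_inf_lt_sup; first exact: freq_bounded.
have [j jab] : exists j, a j != b j.
  apply: contrapT => /forallNP e; apply: ab; apply/funext => j.
  by apply/eqP; rewrite -[_ == _]negbK; apply/negP/e.
apply: (@freq_dyadic_diverges _ _ (fun j => a j == b j) j 0) => //;
  last exact/eqP.
move=> i i0.
apply/idP/eqP => [/close_top_eq|h].
  by move=> /(_ (ltW d2)); rewrite !set_valE.
apply: (@close_top_agree 1); first by rewrite expr1 divff ?pnatr_eq0.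
by move=> [|//] _; rewrite /shift !set_valE /= add0n.
Qed.

End Dynamics.

(** * Conclusion *)

Lemma blocks_inj : injective blocks.
Proof.
move=> a b ab; apply/funext => j.
have := congr1 (fun xi => xi (2 ^ 2 ^ j)%N) ab.
by rewrite /blocks /block_code trunc_expnK// pfactorK.
Qed.

(** Cantor's diagonal argument, with the bit at 0 kept free. *)
Lemma uncountable_binary (T : Type) (F : (nat -> bool) -> T) :
  injective F -> ~ countable [set F a | a in [set a | a 0%N = false]].
Proof.
move=> Finj /countable_injP[g ginj].
have /choice[c hc] : forall n, exists c : nat -> bool,
    forall a, a 0%N = false -> g (F a) = n -> a = c.
  move=> n; have [[a [a0 an]]|na] :=
      pselect (exists a : nat -> bool, a 0%N = false /\ g (F a) = n).
    exists a => b b0 bn; apply/Finj/ginj; rewrite ?inE ?an//.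
      by exists b.
    by exists a.
  by exists (fun=> false) => a a0 an; exfalso; apply: na; exists a.
pose d n := if n is m.+1 then ~~ c m n else false.
have := hc (g (F d)) d erefl erefl.
move/(congr1 (fun a => a (g (F d)).+1)); rewrite {1}/d.
by case: (c _ _).
Qed.

Lemma at_stem_blocks_inj (R : realType) :
  injective (fun a => at_stem (blocks_leaf R a, 1)).
Proof.
move=> a b /at_stem_eq; rewrite stem_dist_top /=.
case: merge_seqP => [/blocks_inj//|n _ _ h]; exfalso; have := exp2_gt0 R n; lra.
Qed.

Theorem theorem8 (R : realType) :
  (exists (X : metricType R) (f : X -> X),
     [/\ dendrite X, continuous f,
         exists S : set X, ~ countable S /\ DC3_set f S &
         ~ exists S : set X, ~ countable S /\ DC2_set f S]) /\
  (exists (X : metricType R) (f : X -> X),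
     [/\ dendrite X, continuous f,
         exists x y : X, DC3_pair f x y &
         ~ exists x y : X, DC2_pair f x y]).
Proof.
pose X : metricType R := system R; pose f : X -> X := @tree_shift R.
have dX : dendrite X := seq_tree_dendrite R.
have cf : continuous f := @tree_shift_continuous R.
pose code a : X := at_stem (blocks_leaf R a, 1).
pose S := [set code a | a in [set a | a 0%N = false]].
have uS : ~ countable S by apply: uncountable_binary; exact: at_stem_blocks_inj.
have S3 : DC3_set f S.
  move=> _ _ [a a0 <-] [b b0 <-] ab; apply: DC3_blocks; first by rewrite a0 b0.
  by move=> e; apply: ab; rewrite e.
split; exists X, f; split=> //.
- by exists S.
- move=> [S' [uS' S2]]; apply: uS'.
  have [->|/set0P[x Sx]] := eqVneq S' set0; first exact: countable0.
  rewrite (_ : S' = [set x]); first exact: countable1.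
  apply/seteqP; split=> [y Sy|_ ->//]; apply: contrapT => yx.
  exact: no_DC2_pair (S2 _ _ Sy Sx yx).
- exists (code (fun=> false)), (code (fun n => n != 0%N));
  apply: DC3_blocks => //.
  by move=> /(congr1 (fun a => a 1%N)).
- by move=> [x [y]]; exact: no_DC2_pair.
Qed.
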